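(* Let $\Lambda=\begin{pmatrix} A & A\otimes B \\ B\otimes A & B \end{pmatrix}$ be a square algebra where the corner bimodules $M=B\otimes A$ and $N=A\otimes B$ are free of rank one. The algebra $\Lambda$ is a null-square algebra (that is, $\alpha=0$ and $\beta=0$), except if $A=B=k$.
   Context: $k$ is a field; algebras are nonzero associative unital $k$-algebras, not necessarily finite dimensional; $\otimes=\otimes_k$. A square algebra is given by algebras $A$ and $B$, a $B$-$A$-bimodule $M$, an $A$-$B$-bimodule $N$ (the corner bimodules), and bimodule maps $\alpha:N\otimes_BM\to A$ and $\beta:M\otimes_AN\to B$ satisfying the associativity constraints: for all $m,m'\in M$, $n,n'\in N$, $\beta(m\otimes n)m'=m\,\alpha(n\otimes m')$ and $\alpha(n\otimes m)n'=n\,\beta(m\otimes n')$. The square algebra is $\begin{pmatrix} A & N \\ M & B \end{pmatrix}$ with matrix multiplication, where $nm=\alpha(n\otimes m)$ and $mn=\beta(m\otimes n)$. It is a null-square algebra if $\alpha=\beta=0$. *)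

(* Defs.v *)
From HB Require Import structures.
From mathcomp Require Import all_boot all_algebra.
From mathcomp Require Import finmap boolp.
From mathcomp.multinomials Require Import monalg.

Set Implicit Arguments.
Unset Strict Implicit.
Unset Printing Implicit Defensive.

Import GRing.Theory.
Local Open Scope ring_scope.

(* [bim_lactZ1] and [bim_ractZ1] are not redundant conditions on top of
   biadditivity: they say that k acts in the same way through A, through B and
   through the k-space structure, i.e. that k acts centrally. The case c = 1
   gives unitality ([bim_lact1], [bim_ract1]). *)
Record bimodule (k : fieldType) (A B : algType k) := Bimodule {
  bim_sort :> lmodType k;
  bim_lact : A -> bim_sort -> bim_sort;
  bim_ract : bim_sort -> B -> bim_sort;
  bim_lactDl : forall x, {morph bim_lact^~ x : a b / a + b};
  bim_lactDr : forall a, {morph bim_lact a : x y / x + y};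
  bim_lactA : forall a b x, bim_lact (a * b) x = bim_lact a (bim_lact b x);
  bim_lactZ1 : forall c x, bim_lact c%:A x = c *: x;
  bim_ractDl : forall b, {morph bim_ract^~ b : x y / x + y};
  bim_ractDr : forall x, {morph bim_ract x : a b / a + b};
  bim_ractA : forall x a b, bim_ract x (a * b) = bim_ract (bim_ract x a) b;
  bim_ractZ1 : forall x c, bim_ract x c%:A = c *: x;
  bim_lractA : forall a x b,
    bim_ract (bim_lact a x) b = bim_lact a (bim_ract x b)
}.

Declare Scope bimodule_scope.
Delimit Scope bimodule_scope with BM.
Local Open Scope bimodule_scope.

Reserved Notation "a *<: x" (at level 40, left associativity).
Reserved Notation "x :>* b" (at level 40, left associativity).
Notation "a *<: x" := (bim_lact a x) : bimodule_scope.
Notation "x :>* b" := (bim_ract x b) : bimodule_scope.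

Section BimoduleTheory.
Variables (k : fieldType) (A B : algType k) (M : bimodule A B).
Implicit Types (x y : M) (a : A) (b : B) (c : k).

Lemma bim_lact1 x : 1 *<: x = x.
Proof. by rewrite -[1]scale1r bim_lactZ1 scale1r. Qed.

Lemma bim_ract1 x : x :>* 1 = x.
Proof. by rewrite -[1]scale1r bim_ractZ1 scale1r. Qed.

Lemma bim_lactZr c a x : a *<: (c *: x) = c *: (a *<: x).
Proof. by rewrite -!bim_lactZ1 -!bim_lactA mulr_algl mulr_algr. Qed.

Lemma bim_ractZl c x b : (c *: x) :>* b = c *: (x :>* b).
Proof. by rewrite -!bim_ractZ1 -!bim_ractA mulr_algl mulr_algr. Qed.

Lemma bim_lactZl c a x : (c *: a) *<: x = c *: (a *<: x).
Proof. by rewrite -[c *: a]mulr_algl bim_lactA bim_lactZ1. Qed.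

Lemma bim_ractZr c x b : x :>* (c *: b) = c *: (x :>* b).
Proof. by rewrite -[c *: b]mulr_algr bim_ractA bim_ractZ1. Qed.

End BimoduleTheory.

Record bimod_hom (k : fieldType) (A B : algType k) (M N : bimodule A B) :=
  BimodHom {
    bim_fun :> M -> N;
    bim_funD : {morph bim_fun : x y / x + y};
    bim_funl : forall a x, bim_fun (a *<: x) = a *<: bim_fun x;
    bim_funr : forall x b, bim_fun (x :>* b) = bim_fun x :>* b
  }.

(* The tensor product over B of an A-B-bimodule and a B-C-bimodule: the free
   k-space on M * N modulo the subspace spanned by [tens_gen]. *)
Section Tensor.
Variables (k : fieldType) (A B C : algType k).
Variables (M : bimodule A B) (N : bimodule B C).

Definition tens_free : lmodType k := {malg k[(M * N)%type]}.

Definition tens_free_pure (m : M) (n : N) : tens_free := << (m, n) >>.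

Inductive tens_gen : tens_free -> Prop :=
| TensGenDl m m' n : tens_gen
    (tens_free_pure (m + m') n - (tens_free_pure m n + tens_free_pure m' n))
| TensGenDr m n n' : tens_gen
    (tens_free_pure m (n + n') - (tens_free_pure m n + tens_free_pure m n'))
| TensGenZ c m n : tens_gen
    (tens_free_pure (c *: m) n - c *: tens_free_pure m n)
| TensGenB m b n : tens_gen
    (tens_free_pure (m :>* b) n - tens_free_pure m (b *<: n)).

Definition tens_rel : {pred tens_free} := fun x =>
  `[< forall S : tens_free -> Prop,
        S 0 -> (forall c x y, S x -> S y -> S (c *: x + y)) ->
        (forall x, tens_gen x -> S x) -> S x >].

Lemma tens_relP x : reflect
  (forall S : tens_free -> Prop,
     S 0 -> (forall c x y, S x -> S y -> S (c *: x + y)) ->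
     (forall x, tens_gen x -> S x) -> S x)
  (x \in tens_rel).
Proof. exact: asboolP. Qed.

Lemma tens_rel_submod : submod_closed tens_rel.
Proof.
split=> [|c x y /tens_relP Sx /tens_relP Sy]; apply/tens_relP => // S S0 SD SG.
exact: SD (Sx S S0 SD SG) (Sy S S0 SD SG).
Qed.

HB.instance Definition _ :=
  GRing.isSubmodClosed.Build k tens_free tens_rel tens_rel_submod.

Lemma tens_rel_gen x : tens_gen x -> x \in tens_rel.
Proof. by move=> gx; apply/tens_relP => S _ _; apply. Qed.

Definition tens : Type := Quotient.quot tens_rel.
HB.instance Definition _ := GRing.Zmodule.on tens.

Definition tens_pi (x : tens_free) : tens := \pi_(Quotient.quot tens_rel)%qT x.

Definition tens_repr (t : tens) : tens_free :=
  generic_quotient.repr (t : Quotient.quot tens_rel).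

Lemma tens_reprK t : tens_pi (tens_repr t) = t.
Proof. exact: generic_quotient.reprK. Qed.

Lemma tens_piD : {morph tens_pi : x y / x + y}.
Proof. exact: Quotient.pi_add. Qed.

Lemma tens_piP x y : reflect (tens_pi x = tens_pi y) (x - y \in tens_rel).
Proof. by rewrite Quotient.idealrBE; apply: eqP. Qed.

Definition tens_scale (c : k) (t : tens) : tens := tens_pi (c *: tens_repr t).

Lemma tens_scale_pi c x : tens_scale c (tens_pi x) = tens_pi (c *: x).
Proof.
apply/tens_piP; rewrite -scalerBr; apply: rpredZ; apply/tens_piP.
exact: tens_reprK.
Qed.

Fact tens_scaleA c d t : tens_scale c (tens_scale d t) = tens_scale (c * d) t.
Proof. by rewrite -[t]tens_reprK !tens_scale_pi scalerA. Qed.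

Fact tens_scale1 : left_id 1 tens_scale.
Proof. by move=> t; rewrite -[t]tens_reprK tens_scale_pi scale1r. Qed.

Fact tens_scaleDr : right_distributive tens_scale +%R.
Proof.
move=> c t u; rewrite -[t]tens_reprK -[u]tens_reprK -tens_piD !tens_scale_pi.
by rewrite scalerDr tens_piD.
Qed.

Fact tens_scaleDl t : {morph tens_scale^~ t : c d / c + d}.
Proof.
by move=> c d; rewrite -[t]tens_reprK !tens_scale_pi scalerDl tens_piD.
Qed.

HB.instance Definition _ := GRing.Zmodule_isLmodule.Build k tens
  tens_scaleA tens_scale1 tens_scaleDr tens_scaleDl.

Lemma tens_piZ c x : tens_pi (c *: x) = c *: tens_pi x.
Proof. by rewrite -tens_scale_pi. Qed.

Definition tens_pure (m : M) (n : N) : tens := tens_pi (tens_free_pure m n).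

Lemma tens_pureDl m m' n : tens_pure (m + m') n = tens_pure m n + tens_pure m' n.
Proof. by rewrite -tens_piD; apply/tens_piP/tens_rel_gen/TensGenDl. Qed.

Lemma tens_pureDr m n n' : tens_pure m (n + n') = tens_pure m n + tens_pure m n'.
Proof. by rewrite -tens_piD; apply/tens_piP/tens_rel_gen/TensGenDr. Qed.

Lemma tens_pureZl c m n : tens_pure (c *: m) n = c *: tens_pure m n.
Proof. by rewrite -tens_piZ; apply/tens_piP/tens_rel_gen/TensGenZ. Qed.

Lemma tens_pureB m b n : tens_pure (m :>* b) n = tens_pure m (b *<: n).
Proof. exact/tens_piP/tens_rel_gen/TensGenB. Qed.

Lemma tens_pureZr c m n : tens_pure m (c *: n) = c *: tens_pure m n.
Proof. by rewrite -bim_lactZ1 -tens_pureB bim_ractZ1 tens_pureZl. Qed.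

Lemma tens_ind (P : tens -> Prop) :
  (forall m n, P (tens_pure m n)) -> (forall t u, P t -> P u -> P (t + u)) ->
  forall t, P t.
Proof.
move=> Pp PD t; rewrite -[t]tens_reprK (monalgE (tens_repr t)).
elim: (enum_fset _) => [|[m n] s IHs].
  rewrite big_nil; have <- : tens_pure 0 0 = tens_pi 0.
    by rewrite -(scale0r 0) tens_pureZl -tens_piZ !scale0r.
  exact: Pp.
rewrite big_cons tens_piD; apply: PD IHs.
set c := (_)@_ _; suff -> : tens_pi << c *g (m, n) >> = tens_pure (c *: m) n by [].
rewrite tens_pureZl -tens_piZ; congr tens_pi.
by apply/malgP => p; rewrite mcoeffZ !mcoeffU mulrnAr mulr1.
Qed.

Definition tens_balanced (V : lmodType k) (f : M -> N -> V) :=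
  [/\ forall n, {morph f^~ n : m m' / m + m'},
      forall m, {morph f m : n n' / n + n'},
      forall c m n, f (c *: m) n = c *: f m n
    & forall m b n, f (m :>* b) n = f m (b *<: n)].

Definition tens_free_lift (V : lmodType k) (f : M -> N -> V) (x : tens_free) : V :=
  \sum_(p <- msupp x) x@_p *: f p.1 p.2.

Definition tens_lift (V : lmodType k) (f : M -> N -> V) (t : tens) : V :=
  tens_free_lift f (tens_repr t).

Section Lift.
Variables (V : lmodType k) (f : M -> N -> V).

Lemma tens_free_liftw (d : {fset (M * N)%type}) x : (msupp x `<=` d)%fset ->
  tens_free_lift f x = \sum_(p <- d) x@_p *: f p.1 p.2.
Proof.
move=> sxd; rewrite /tens_free_lift (big_fset_incl _ sxd) //= => p _.
by move=> /mcoeff_outdom ->; rewrite scale0r.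
Qed.

Lemma tens_free_lift_linear c x y :
  tens_free_lift f (c *: x + y) = c *: tens_free_lift f x + tens_free_lift f y.
Proof.
pose d := (msupp x `|` msupp y)%fset.
have sx : (msupp x `<=` d)%fset by apply: fsubsetUl.
have sy : (msupp y `<=` d)%fset by apply: fsubsetUr.
have sz : (msupp (c *: x + y) `<=` d)%fset.
  apply: fsubset_trans (msuppD_le _ _) _; apply: fsetSU; exact: msuppZ_le.
rewrite (tens_free_liftw sx) (tens_free_liftw sy) (tens_free_liftw sz).
rewrite scaler_sumr -big_split /=; apply: eq_bigr => p _.
by rewrite mcoeffD mcoeffZ scalerDl scalerA.
Qed.

Lemma tens_free_lift_pure m n : tens_free_lift f (tens_free_pure m n) = f m n.
Proof.
rewrite /tens_free_lift /tens_free_pure msuppU oner_eq0 big_seq_fset1.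
by rewrite mcoeffUU scale1r.
Qed.

Hypothesis fb : tens_balanced f.

Lemma tens_free_lift_rel x : x \in tens_rel -> tens_free_lift f x = 0.
Proof.
have L0 : tens_free_lift f 0 = 0 by rewrite /tens_free_lift msupp0 big_nil.
have LD y z : tens_free_lift f (y + z) = tens_free_lift f y + tens_free_lift f z.
  by rewrite -[y]scale1r tens_free_lift_linear !scale1r.
have LZ c y : tens_free_lift f (c *: y) = c *: tens_free_lift f y.
  by rewrite -[c *: y]addr0 tens_free_lift_linear L0 addr0.
have LN y : tens_free_lift f (- y) = - tens_free_lift f y.
  by rewrite -scaleN1r LZ scaleN1r.
case: fb => fDl fDr fZ fB /tens_relP /(_ (fun y => tens_free_lift f y = 0)); apply.
- exact: L0.
- by move=> c y z fy fz; rewrite tens_free_lift_linear fy fz scaler0 addr0.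
move=> _ [].
- by move=> *; rewrite !(LD, LN) !tens_free_lift_pure fDl subrr.
- by move=> *; rewrite !(LD, LN) !tens_free_lift_pure fDr subrr.
- by move=> *; rewrite !(LD, LN, LZ) !tens_free_lift_pure fZ subrr.
- by move=> *; rewrite !(LD, LN) !tens_free_lift_pure fB subrr.
Qed.

Lemma tens_lift_pi x : tens_lift f (tens_pi x) = tens_free_lift f x.
Proof.
have /tens_piP/tens_free_lift_rel := tens_reprK (tens_pi x).
rewrite addrC -scaleN1r tens_free_lift_linear scaleN1r addrC.
by move/subr0_eq.
Qed.

Lemma tens_lift_pure m n : tens_lift f (tens_pure m n) = f m n.
Proof. by rewrite tens_lift_pi tens_free_lift_pure. Qed.

Lemma tens_lift_linear : linear (tens_lift f).
Proof.
move=> c t u; rewrite -[t]tens_reprK -[u]tens_reprK -tens_piZ -tens_piD.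
by rewrite !tens_lift_pi tens_free_lift_linear.
Qed.

Lemma tens_liftD : {morph tens_lift f : t u / t + u}.
Proof. by move=> t u; rewrite -[t]scale1r tens_lift_linear !scale1r. Qed.

End Lift.

Definition tens_lact (a : A) : tens -> tens :=
  tens_lift (fun m n => tens_pure (a *<: m) n).
Definition tens_ract (t : tens) (c : C) : tens :=
  tens_lift (fun m n => tens_pure m (n :>* c)) t.

Fact tens_lact_balanced a : tens_balanced (fun m n => tens_pure (a *<: m) n).
Proof.
split=> [n m m'|m n n'|c m n|m b n].
- by rewrite bim_lactDr tens_pureDl.
- by rewrite tens_pureDr.
- by rewrite bim_lactZr tens_pureZl.
- by rewrite -bim_lractA tens_pureB.
Qed.

Fact tens_ract_balanced c : tens_balanced (fun m n => tens_pure m (n :>* c)).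
Proof.
split=> [n m m'|m n n'|d m n|m b n].
- by rewrite tens_pureDl.
- by rewrite bim_ractDl tens_pureDr.
- by rewrite tens_pureZl.
- by rewrite tens_pureB bim_lractA.
Qed.

Lemma tens_lactE a m n : tens_lact a (tens_pure m n) = tens_pure (a *<: m) n.
Proof. exact: tens_lift_pure (tens_lact_balanced a) m n. Qed.

Lemma tens_ractE m n c : tens_ract (tens_pure m n) c = tens_pure m (n :>* c).
Proof. exact: tens_lift_pure (tens_ract_balanced c) m n. Qed.

Fact tens_lactDr a : {morph tens_lact a : t u / t + u}.
Proof. exact: tens_liftD (tens_lact_balanced a). Qed.

Fact tens_ractDl c : {morph tens_ract^~ c : t u / t + u}.
Proof. exact: tens_liftD (tens_ract_balanced c). Qed.

Fact tens_lactDl t : {morph tens_lact^~ t : a b / a + b}.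
Proof.
move=> a b; elim/tens_ind: t => [m n|t u IHt IHu].
  by rewrite !tens_lactE bim_lactDl tens_pureDl.
by rewrite 3!tens_lactDr IHt IHu; apply: addrACA.
Qed.

Fact tens_ractDr t : {morph tens_ract t : a b / a + b}.
Proof.
move=> a b; elim/tens_ind: t => [m n|t u IHt IHu].
  by rewrite !tens_ractE bim_ractDr tens_pureDr.
by rewrite 3!tens_ractDl IHt IHu; apply: addrACA.
Qed.

Fact tens_lactA a b t : tens_lact (a * b) t = tens_lact a (tens_lact b t).
Proof.
elim/tens_ind: t => [m n|t u IHt IHu]; first by rewrite !tens_lactE bim_lactA.
by rewrite 3!tens_lactDr -IHt -IHu.
Qed.

Fact tens_ractA t a b : tens_ract t (a * b) = tens_ract (tens_ract t a) b.
Proof.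
elim/tens_ind: t => [m n|t u IHt IHu]; first by rewrite !tens_ractE bim_ractA.
by rewrite 3!tens_ractDl -IHt -IHu.
Qed.

Fact tens_lactZ1 c t : tens_lact c%:A t = c *: t.
Proof.
elim/tens_ind: t => [m n|t u IHt IHu].
  by rewrite tens_lactE bim_lactZ1 tens_pureZl.
by rewrite tens_lactDr IHt IHu scalerDr.
Qed.

Fact tens_ractZ1 t c : tens_ract t c%:A = c *: t.
Proof.
elim/tens_ind: t => [m n|t u IHt IHu].
  by rewrite tens_ractE bim_ractZ1 tens_pureZr.
by rewrite tens_ractDl IHt IHu scalerDr.
Qed.

Fact tens_lractA a t c :
  tens_ract (tens_lact a t) c = tens_lact a (tens_ract t c).
Proof.
elim/tens_ind: t => [m n|t u IHt IHu].
  by rewrite tens_lactE !tens_ractE tens_lactE.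
by rewrite !(tens_lactDr, tens_ractDl) IHt IHu.
Qed.

Definition tens_bimod : bimodule A C :=
  @Bimodule k A C tens tens_lact tens_ract tens_lactDl tens_lactDr tens_lactA
    tens_lactZ1 tens_ractDl tens_ractDr tens_ractA tens_ractZ1 tens_lractA.

End Tensor.

Section Regular.
Variables (k : fieldType) (A : algType k).

Fact regular_scalerA (x : A) (c d : k) : (c * d) *: x = d *: (c *: x).
Proof. by rewrite scalerA mulrC. Qed.

Fact regular_scale_alg (c : k) (x : A) : (c * 1) *: x = c *: x.
Proof. by rewrite mulr1. Qed.

Definition regular_bimod : bimodule A A :=
  @Bimodule k A A A *%R *%R
    (fun x a b => mulrDl a b x) (@mulrDr A) (fun a b x => esym (mulrA a b x))
    (@mulr_algl k A)
    (fun b x y => mulrDl x y b) (@mulrDr A) (@mulrA A)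
    (fun x c => mulr_algr c x)
    (fun a x b => esym (mulrA a x b)).

Definition regular_left_bimod : bimodule A k^o :=
  @Bimodule k A k^o A *%R (fun (x : A) (c : k) => c *: x)
    (fun x a b => mulrDl a b x) (@mulrDr A) (fun a b x => esym (mulrA a b x))
    (@mulr_algl k A)
    (fun (c : k) (x y : A) => scalerDr c x y)
    (fun (x : A) (c d : k) => scalerDl x c d)
    regular_scalerA
    (fun x c => regular_scale_alg c x)
    (fun a x (c : k) => scalerAr c a x).

Definition regular_right_bimod : bimodule k^o A :=
  @Bimodule k k^o A A (fun (c : k) (x : A) => c *: x) *%R
    (fun (x : A) (c d : k) => scalerDl x c d)
    (fun (c : k) (x y : A) => scalerDr c x y)
    (fun (c d : k) (x : A) => esym (scalerA c d x))
    regular_scale_alg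
    (fun b x y => mulrDl x y b) (@mulrDr A) (@mulrA A)
    (fun x c => mulr_algr c x)
    (fun (c : k) x b => esym (scalerAl c x b)).

End Regular.

(* The free A-B-bimodule of rank one, i.e. the tensor product of A and B over k,
   with A acting on the left factor and B on the right factor. *)
Definition free_bimod (k : fieldType) (A B : algType k) : bimodule A B :=
  tens_bimod (regular_left_bimod A) (regular_right_bimod B).

(* The data of the square algebra [[A, N], [M, B]]; the product n m of its
   entries is [sq_alpha], and m n is [sq_beta]. *)
Record square_algebra (k : fieldType) (A B : algType k)
    (M : bimodule B A) (N : bimodule A B) := SquareAlgebra {
  sq_alpha : bimod_hom (tens_bimod N M) (regular_bimod A);
  sq_beta : bimod_hom (tens_bimod M N) (regular_bimod B);
  sq_assocM : forall (m m' : M) (n : N),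
    sq_beta (tens_pure m n) *<: m' = m :>* sq_alpha (tens_pure n m');
  sq_assocN : forall (n n' : N) (m : M),
    sq_alpha (tens_pure n m) *<: n' = n :>* sq_beta (tens_pure m n')
}.

Definition null_square (k : fieldType) (A B : algType k)
    (M : bimodule B A) (N : bimodule A B) (L : square_algebra M N) : Prop :=
  (forall t, sq_alpha L t = 0) /\ (forall t, sq_beta L t = 0).

(* A = k, meaning that the structure map of A is an isomorphism. *)
Definition is_base_field (k : fieldType) (A : algType k) : Prop :=
  bijective (in_alg A).

(* Main.v *)
Require Import Defs.
From HB Require Import structures.
From mathcomp Require Import all_boot all_algebra.
From mathcomp Require Import boolp classical_sets.

(** A bimodule map out of [A (x) B (x) A = N (x)_B M] is determined by the
    linear map [phi : B -> A], [phi b = alpha ((1 (x) b) (x) (1 (x) 1))];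
    likewise [beta] is determined by [psi : A -> B]
    ([free_tens_hom_eq0] is the part of this that matters).  On generators the
    associativity constraint reads
      [(psi a * b) (x) 1 = 1 (x) (a * phi b)]   in [B (x) A],
    for all [a] and [b] ([square_generators]).  An equality
    [x (x) 1 = 1 (x) y] forces [x] and [y] to be the same scalar
    ([tens_pure_1_scalar]), so there are scalars with
      [psi a * b = c = a * phi b].
    With [a = 1], the scalar [phi b] equals [psi 1 * b], so [psi 1] is nonzero
    as soon as some [phi b] is; with [b = 1], [phi 1] is nonzero as soon as some
    [psi a] is.  So if [alpha] or [beta] is nonzero, both [phi] and [psi] take a
    nonzero value, and this value is a scalar.  Since its multiples
    [a' * phi b] and [psi a * b'] are scalars for all [a'] and [b'], every
    element of [A] and every element of [B] is a scalar: [A = B = k].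

    Separating scalars inside a tensor product uses a linear functional on the
    algebra that sends 1 to 1; as the algebras may be infinite dimensional, it
    comes from Zorn's lemma ([exists_functional]). *)

Set Implicit Arguments.
Unset Strict Implicit.
Unset Printing Implicit Defensive.

Import GRing.Theory.
Local Open Scope ring_scope.
Local Open Scope bimodule_scope.

(** * Linear functionals *)

(** The kernel of the functional is a subspace maximal among those that avoid
    [v]: maximality makes it a complement of the line through [v], and the
    functional is the coordinate along [v]. *)
Lemma exists_functional (k : fieldType) (V : lmodType k) (v : V) : v != 0 ->
  exists f : {scalar V}, f v = 1.
Proof.
move=> v0.
(* [0] is not required to lie in the subspaces, so that the empty chain has an
   upper bound. *)
pose P (X : set V) := (forall c x y, X x -> X y -> X (c *: x + y)) /\ ~ X v.
have [F FP Ftot|W [[WD Wv] Wmax]] := @Zorn_bigcup V P.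
  split=> [c x y [X FX Xx] [Y FY Yy]|[X /FP [_ NXv] /NXv//]].
  have [XY|YX] := Ftot _ _ FX FY.
    by exists Y => //; apply: (FP _ FY).1 => //; apply: XY.
  by exists X => //; apply: (FP _ FX).1 => //; apply: YX.
have W0 : W 0.
  apply: contrapT => NW0; apply: (Wmax [set 0]%classic).
    split=> [w Ww|]; last by move=> /(_ 0 erefl).
    by case: NW0; rewrite -(subrr w) addrC -scaleN1r; apply: WD.
  split=> [c x y -> ->|/esym/eqP]; first by rewrite scaler0 addr0.
  by rewrite eq_sym (negPf v0).
have WZ c x : W x -> W (c *: x).
  by move=> Wx; rewrite -[_ *: _]addr0; apply: WD.
have coordP u : exists c, W (u - c *: v).
  have [Wu|NWu] := pselect (W u); first by exists 0; rewrite scale0r subr0.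
  pose X : set V := fun x => exists c, W (x - c *: u).
  have [[d Wd]|NXv] := pselect (X v).
    have d0 : d != 0.
      by apply/eqP => d0; apply: Wv; rewrite d0 scale0r subr0 in Wd.
    exists d^-1; suff -> : u - d^-1 *: v = - d^-1 *: (v - d *: u) by apply: WZ.
    by rewrite scalerBr scalerA mulNr mulVf // !scaleNr scale1r opprK addrC.
  case: (Wmax X); split=> //.
  - by move=> x Wx; exists 0; rewrite scale0r subr0.
  - by move=> XW; apply/NWu/XW; exists 1; rewrite scale1r subrr.
  - move=> c x y [dx Wx] [dy Wy]; exists (c * dx + dy).
    by rewrite scalerDl opprD addrACA -scalerA -scalerBr; apply: WD.
have coord_uniq u c d : W (u - c *: v) -> W (u - d *: v) -> c = d.
  move=> Wc Wd; apply/eqP/contraT => cd; case: Wv.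
  have cd0 : d - c != 0 by rewrite subr_eq0 eq_sym.
  suff -> : v = (d - c)^-1 *: (-1 *: (u - d *: v) + (u - c *: v)).
    exact/WZ/WD.
  rewrite scaleN1r opprB addrA subrK -scalerBl scalerA mulVf ?scale1r //.
have [f fP] := choice coordP.
have f_lin : scalar f.
  move=> c x y; apply: coord_uniq (fP _) _.
  by rewrite scalerDl opprD addrACA -scalerA -scalerBr; apply: WD.
pose F : {scalar V} := HB.pack f (GRing.isLinear.Build k V k *%R f f_lin).
by exists F; apply: coord_uniq (fP v) _; rewrite scale1r subrr.
Qed.

Lemma scalars_is_base_field (k : fieldType) (A : algType k) :
  (forall a : A, exists c : k, a = c%:A) -> is_base_field A.
Proof.
move=> Ak; have [g gP] := choice Ak.
exists g => [c|a]; last by rewrite /= -gP.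
exact/(fmorph_inj (in_alg A))/esym/gP.
Qed.

(** * Scalars in the free bimodule of rank one *)

(** Contracting one tensor factor by a functional that maps 1 to 1 shows that
    [x] and [y] are scalars, and then that the two scalars agree. *)
Lemma tens_pure_1_scalar (k : fieldType) (A B : algType k) (x : A) (y : B) :
  tens_pure (x : regular_left_bimod A) (1 : regular_right_bimod B) =
    tens_pure (1 : regular_left_bimod A) (y : regular_right_bimod B) ->
  exists2 c : k, x = c%:A & y = c%:A.
Proof.
move=> xy.
have [f f1] := exists_functional (oner_neq0 A).
have [g g1] := exists_functional (oner_neq0 B).
pose F (a : regular_left_bimod A) (b : regular_right_bimod B) : A := g b *: a.
pose G (a : regular_left_bimod A) (b : regular_right_bimod B) : B := f a *: b.
have Fb : tens_balanced F.
  split=> [b a a'|a b b'|c a b|a c b]; rewrite /F.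
  - by rewrite scalerDr.
  - by rewrite linearD scalerDl.
  - by rewrite !scalerA mulrC.
  - by rewrite /= [in RHS]linearZ /= !scalerA mulrC.
have Gb : tens_balanced G.
  split=> [b a a'|a b b'|c a b|a c b]; rewrite /G.
  - by rewrite linearD scalerDl.
  - by rewrite scalerDr.
  - by rewrite [in LHS]linearZ /= !scalerA.
  - by rewrite /= [in LHS]linearZ /= !scalerA mulrC.
have := congr1 (tens_lift F) xy.
rewrite !(tens_lift_pure Fb) /F g1 scale1r => xE.
have := congr1 (tens_lift G) xy.
rewrite !(tens_lift_pure Gb) /G f1 scale1r => yE.
by exists (f x) => //; rewrite xE linearZ /= f1 mulr1.
Qed.

Section FreeGenerators.
Variables (k : fieldType) (A B : algType k).

Definition free_pure (a : A) (b : B) : free_bimod A B :=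
  @tens_pure k A k^o B (regular_left_bimod A) (regular_right_bimod B) a b.

Lemma free_pure_lact a a' b : a *<: free_pure a' b = free_pure (a * a') b.
Proof. exact: tens_lactE. Qed.

Lemma free_pure_ract a b b' : free_pure a b :>* b' = free_pure a (b * b').
Proof. exact: tens_ractE. Qed.

Lemma free_ind (P : free_bimod A B -> Prop) :
  (forall a b, P (free_pure a b)) -> (forall x y, P x -> P y -> P (x + y)) ->
  forall x, P x.
Proof. exact: (@tens_ind k A k^o B (regular_left_bimod A) (regular_right_bimod B) P). Qed.

End FreeGenerators.

(** The map [b |-> (1 (x) b) (x) (1 (x) 1)] picks out a generating set of the
    bimodule [(A (x) B) (x)_B (B (x) A)]. *)
Lemma free_tens_hom_eq0 (k : fieldType) (A B : algType k) (M : bimodule A A)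
    (h : bimod_hom (tens_bimod (free_bimod A B) (free_bimod B A)) M) :
  (forall b, h (tens_pure (free_pure 1 b) (free_pure 1 1)) = 0) ->
  forall t, h t = 0.
Proof.
move=> h0 t.
have lact0 a : a *<: (0 : M) = 0.
  by apply: (addrI (a *<: (0 : M))); rewrite -bim_lactDr !addr0.
have ract0 a : (0 : M) :>* a = 0.
  by apply: (addrI ((0 : M) :>* a)); rewrite -bim_ractDl !addr0.
have hD0 u v : h u = 0 -> h v = 0 -> h (u + v) = 0.
  by move=> hu hv; rewrite bim_funD hu hv addr0.
elim/tens_ind: t => [n m|t u IHt IHu]; last exact: hD0.
elim/free_ind: n => [a b|n n' IHn IHn'].
  elim/free_ind: m => [b' a'|m m' IHm IHm'].
    have -> : free_pure b' a' = b' *<: (free_pure 1 1 :>* a').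
      by rewrite free_pure_ract free_pure_lact mulr1 mul1r.
    rewrite -tens_pureB free_pure_ract -[a]mulr1 -free_pure_lact.
    have -> : tens_pure (a *<: free_pure 1 (b * b')) (free_pure 1 1 :>* a') =
       (a *<: (tens_pure (free_pure 1 (b * b')) (free_pure 1 1)
                 : tens_bimod (free_bimod A B) (free_bimod B A))) :>* a'.
      by rewrite /= tens_lactE tens_ractE.
    by rewrite bim_funr bim_funl h0 lact0 ract0.
  by rewrite tens_pureDr; exact: hD0 IHm IHm'.
by rewrite tens_pureDl; exact: hD0 IHn IHn'.
Qed.

(** * Free square algebras *)

Section FreeSquare.
Variables (k : fieldType) (A B : algType k).
Variable L : square_algebra (free_bimod B A) (free_bimod A B).

Definition phi (b : B) : A := sq_alpha L (tens_pure (free_pure 1 b) (free_pure 1 1)).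
Definition psi (a : A) : B := sq_beta L (tens_pure (free_pure 1 a) (free_pure 1 1)).

(** Both sides come from the product of [1 (x) a] in [M], [1 (x) b] in [N] and
    [1 (x) 1] in [M]. *)
Lemma square_generators a b : exists2 c : k, psi a * b = c%:A & a * phi b = c%:A.
Proof.
apply: tens_pure_1_scalar.
have := sq_assocM L (free_pure 1 a) (free_pure 1 1) (free_pure 1 b).
have -> : sq_beta L (tens_pure (free_pure 1 a) (free_pure 1 b)) = psi a * b.
  rewrite /psi -[RHS]/(_ :>* b) -bim_funr /=.
  by rewrite tens_ractE free_pure_ract mul1r.
by rewrite free_pure_lact free_pure_ract mulr1.
Qed.

(** Here [phi b = c%:A] for some [c != 0], and [x * phi b = c *: x] is a scalar
    for every [x], hence so is [x]; the same reasoning applies to [psi a] and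
    [B]. *)
Lemma square_base_field a b : phi b != 0 -> psi a != 0 ->
  is_base_field A /\ is_base_field B.
Proof.
move=> pb pa; split; apply: scalars_is_base_field => x.
  have [c _ cE] := square_generators 1 b; rewrite mul1r in cE.
  have c0 : c != 0 by apply: contraNneq pb => c0; rewrite cE c0 scale0r.
  have [d _ dE] := square_generators x b; exists (c^-1 * d).
  by rewrite -scalerA -dE cE mulr_algr scalerA mulVf // scale1r.
have [c cE _] := square_generators a 1; rewrite mulr1 in cE.
have c0 : c != 0 by apply: contraNneq pa => c0; rewrite cE c0 scale0r.
have [d dE _] := square_generators a x; exists (c^-1 * d).
by rewrite -scalerA -dE cE mulr_algl scalerA mulVf // scale1r.
Qed.

(** [psi 1 * b] and [phi b] are the same scalar. *)
Lemma phi_neq0 b : phi b != 0 -> psi 1 != 0.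
Proof.
have [c cB cA] := square_generators 1 b; rewrite mul1r in cA.
apply: contraNneq => p0; move: cB; rewrite p0 mul0r => /esym/eqP.
by rewrite scaler_eq0 oner_eq0 orbF cA => /eqP ->; rewrite scale0r.
Qed.

Lemma psi_neq0 a : psi a != 0 -> phi 1 != 0.
Proof.
have [c cB cA] := square_generators a 1; rewrite mulr1 in cB.
apply: contraNneq => p0; move: cA; rewrite p0 mulr0 => /esym/eqP.
by rewrite scaler_eq0 oner_eq0 orbF cB => /eqP ->; rewrite scale0r.
Qed.

End FreeSquare.

Theorem theorem7p5 (k : fieldType) (A B : algType k)
    (L : square_algebra (free_bimod B A) (free_bimod A B)) :
  ~ (is_base_field A /\ is_base_field B) -> null_square L.
Proof.
move=> Nk; split; apply: free_tens_hom_eq0 => x; apply/eqP/negPn/negP => nz.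
  exact/Nk/(square_base_field nz (phi_neq0 nz)).
exact/Nk/(square_base_field (psi_neq0 nz) nz).
Qed.
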